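(* Let $\kappa \leq \lambda$ be regular cardinals greater than $\aleph_2$. If there exists a stationary subset $S \subseteq E_{<\kappa}^{\lambda}$ such that $S \cap \alpha$ is non-stationary in $\alpha$ for all $\alpha \in E_{<\kappa}^{\lambda}$, then $\mathcal{P}_{\kappa}\lambda \not\to [I_{\kappa\lambda}^{+}]^{3}_{\lambda}$.
   Context: $E^\lambda_{<\kappa}$ is the set of (limit) ordinals below $\lambda$ of cofinality $<\kappa$. $S\cap\alpha$ is non-stationary in $\alpha$ if some club subset of $\alpha$ is disjoint from $S$. $\mathcal{P}_\kappa\lambda=\{x\subseteq\lambda : |x|<\kappa\}$. $I_{\kappa\lambda}$ is the bounded ideal over $\mathcal{P}_\kappa\lambda$, so $I_{\kappa\lambda}^+$ is the collection of unbounded (i.e. $\subseteq$-cofinal) subsets of $\mathcal{P}_\kappa\lambda$. For $X\subseteq\mathcal{P}_\kappa\lambda$, $[X]^n_\subset=\{\{x_0,\dots,x_{n-1}\}\subseteq X : x_0\subset\cdots\subset x_{n-1}\}$ (strict inclusions). The statement $\mathcal{P}_\kappa\lambda\not\to[I_{\kappa\lambda}^+]^n_\lambda$ asserts the existence of a function $c:[\mathcal{P}_\kappa\lambda]^n\to\lambda$ (on $n$-element subsets) such that $c``[X]^n_\subset=\lambda$ for all $X\in I_{\kappa\lambda}^+$. *)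

(* Defs.v *)
From mathcomp Require Import all_boot all_order.
From mathcomp Require Import mathcomp_extra boolp classical_sets functions.
From mathcomp Require Import cardinality wochoice.

Set Implicit Arguments.
Unset Strict Implicit.
Unset Printing Implicit Defensive.

Local Open Scope classical_set_scope.
Local Open Scope card_scope.

(* A cardinal is represented by a well-ordered type which is an initial
   ordinal.  The ordinals below it are the elements of the type: an element a
   stands for the order type of [below a].  The cardinal itself corresponds to
   the initial segment [setT], so notions that apply both to ordinals below
   lambda and to lambda itself are stated for an initial segment D. *)

Definition card_lt (T U : Type) (A : set T) (B : set U) : Prop :=
  A #<= B /\ ~ (A #= B).

(* [is_aleph n A]: |A| = aleph_n.  Every cardinal at most |A| is the
   cardinality of a subset of A, so it suffices to quantify over subsets. *)
Fixpoint is_aleph (n : nat) (T : Type) (A : set T) : Prop :=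
  match n with
  | 0 => A #= [set: nat]
  | m.+1 => exists B : set T, [/\ B `<=` A, is_aleph m B, card_lt B A &
              forall C : set T, C `<=` A -> C #<= B \/ C #= A]
  end.

Definition greater_than_aleph (n : nat) (T : Type) : Prop :=
  exists A : set T, is_aleph n A /\ card_lt A [set: T].

Section Ordinals.
Context {d : Order.disp_t} {T : orderType d}.
Implicit Types (a b x y z : T) (C D S : set T).

Definition below a : set T := [set x | (x < a)%O].

Definition cofinal_in D C : Prop :=
  C `<=` D /\ forall x, D x -> exists2 y, C y & (x <= y)%O.

(* C is a cofinal subset of D of least cardinality: cf(D) = |C|. *)
Definition cofinality_witness D C : Prop :=
  cofinal_in D C /\ forall C', cofinal_in D C' -> C #<= C'.

Definition limit_ordinal a : Prop :=
  below a !=set0 /\ forall x, (x < a)%O -> exists2 y, (x < y)%O & (y < a)%O.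

Definition club_in D C : Prop :=
  cofinal_in D C /\
  forall a, D a -> limit_ordinal a -> cofinal_in (below a) (C `&` below a) ->
    C a.

Definition nonstationary_in D S : Prop :=
  exists C, club_in D C /\ S `&` C = set0.

Definition stationary_in D S : Prop := S `<=` D /\ ~ nonstationary_in D S.

End Ordinals.

Definition regular_cardinal (d : Order.disp_t) (T : orderType d) : Prop :=
  [/\ well_order (fun x y : T => (x <= y)%O),
      infinite_set [set: T],
      forall a : T, card_lt (below a) [set: T]
    & cofinality_witness [set: T] [set: T]].

(* E^lambda_{<kappa}, with kappa = |K| and lambda = L *)
Definition E_lt (K : Type) (d : Order.disp_t) (L : orderType d) : set L :=
  [set a | limit_ordinal a /\
     exists C, cofinality_witness (below a) C /\ card_lt C [set: K]].
Arguments E_lt K {d} L.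

Definition P_kl (K L : Type) : set (set L) := [set x | card_lt x [set: K]].
Arguments P_kl K L : clear implicits.

(* I_{kappa lambda}^+ *)
Definition unbounded (K L : Type) (X : set (set L)) : Prop :=
  X `<=` P_kl K L /\
  forall x, P_kl K L x -> exists2 y, X y & x `<=` y.
Arguments unbounded K {L} X.

Definition nsubsets (n : nat) (U : Type) (P : set U) : set (set U) :=
  [set A | A `<=` P /\ A #= `I_n].

(* [X]^n_{\subset} *)
Definition nchains (n : nat) (L : Type) (X : set (set L)) :
    set (set (set L)) :=
  [set A | exists x : 'I_n -> set L,
     [/\ forall i, X (x i),
         forall i j : 'I_n, (i < j)%N -> x i `<` x j
       & A = range x]].

(* P_kappa lambda -/-> [I_{kappa lambda}^+]^n_lambda *)
Definition not_square_arrow (n : nat) (K L : Type) : Prop :=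
  exists c : nsubsets n (P_kl K L) -> L,
    forall X, unbounded K X ->
      c @` [set A | nchains n X (set_val A)] = [set: L].

(* Main.v *)
Require Import Defs.
From mathcomp Require Import all_boot all_order.
From mathcomp Require Import mathcomp_extra boolp classical_sets functions.
From mathcomp Require Import cardinality wochoice.

Set Implicit Arguments.
Unset Strict Implicit.
Unset Printing Implicit Defensive.
Import Order.TTheory.

Local Open Scope classical_set_scope.
Local Open Scope card_scope.

(** Why the theorem holds.  Write kappa and lambda for the cardinals K and L.
The colour of a chain x0 < x1 < x2 is computed by walking down from sup x2 along
a C-sequence, once towards sup x0 and once towards sup x1, and looking at the
node at which the two walks part ([split_node]).

The C-sequence gives each b in E = E^lambda_{<kappa} a club C_b of b disjoint
from S, which exists as S does not reflect at b; the next node from b towards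
a < b is min (C_b \ a).  Let t be in S, and consider walks that start at or
above t.  As t is not in C_b for b > t in E, the elements of C_b below t
are bounded by some z < t, so that all a in (z, t) have the same next node, which is at least t.
Hence walks towards ordinals close enough to t stay together until they reach
t.  At t they part: the node from t towards a lies in [a, t), and is left
behind by any a' in (min (C_t \ a), t).  So the walks towards a < a' < t part
exactly at t, provided a and then a' are close enough to t ([walk_splits]).

At a limit node b outside E such a club may be missing, since S may reflect at
cofinality kappa or above.  There the set x2 helps: from any b outside E the
walk moves to the supremum of the part of x2 below b.  This is less than b,
because a set with fewer than kappa elements is not cofinal in a limit ordinal
outside E; and it is at least t as soon as t is in x2.

Given an unbounded X, fix extensions inside X: a function g from finite
sequences of ordinals to X such that g (e :: s) properly contains g s and
reaches above e.  Stationary many t are closed under sup o g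
([stationary_closed]).  For such t in S, take D cofinal in t with |D| < kappa;
the union of the g s with s in D^{<omega}, together with t itself, has fewer
than kappa elements, hence is covered by some x2 in X, and the chains
g [e] < g [f, e] < x2 with e and f in D have sup x0 and sup x1 as close to t as
wanted.  So the parting nodes of chains of X exhaust S up to a nonstationary
set.

It remains to compose with a map col : lambda -> lambda all of whose fibres
meet S in a stationary set ([split_stationary]), which is Solovay's splitting
theorem; for a set with an avoiding C-sequence it has a short proof. *)

(** * Comparison of cardinals *)

Section Cardinals.

Lemma card_le_of_inj (T U : Type) (A : set T) (B : set U) (f : T -> U) :
    (forall x, A x -> B (f x)) ->
    (forall x y, A x -> A y -> f x = f y -> x = y) -> A #<= B.
Proof.
move=> fAB finj; have fA : f @` A #= A.
  by apply: inj_card_eq => x y /set_mem Ax /set_mem Ay; apply: finj.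
rewrite -(card_le_eql fA); apply: subset_card_le => _ [x Ax <-]; exact: fAB.
Qed.

Lemma card_le_of_surj (T U : Type) (A : set T) (B : set U) (g : U -> T) :
  (forall x, A x -> exists2 y, B y & g y = x) -> A #<= B.
Proof.
move=> gsurj; apply: card_le_trans (card_image_le g B).
by apply: subset_card_le => x /gsurj.
Qed.

(** The default [u0] only serves to extend the injection to the whole type. *)
Lemma card_le_exinj (T U : Type) (A : set T) (B : set U) (u0 : U) :
    A #<= B -> exists f : T -> U, (forall x, A x -> B (f x)) /\
    (forall x y, A x -> A y -> f x = f y -> x = y).
Proof.
move=> /card_leP[f].
exists (fun x => if pselect (A x) is left Ax then
   set_val (f (SigSub (mem_set Ax))) else u0); split.
  move=> x Ax; case: pselect => // Ax'; exact: set_valP.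
move=> x y Ax Ay; case: pselect => // Ax'; case: pselect => // Ay'.
move=> /val_inj /(inj (f:=f)); rewrite !in_setT => /(_ isT isT).
by move=> /(congr1 val).
Qed.

(** Cardinals are well-ordered.  Apply Zorn's lemma to the sets of choice
functions on which every coordinate is injective: for a maximal such set M some
coordinate i must exhaust [F i], since otherwise a function choosing a value
missed by M in every coordinate could be added.  Then M is a simultaneous graph
of injections of [F i] into all the [F j]. *)
Lemma least_cardinality (I : Type) (i0 : I) (U : I -> Type)
  (F : forall i, set (U i)) : exists i, forall j, F i #<= F j.
Proof.
pose P (M : set (forall i, U i)) :=
  (forall f, M f -> forall i, F i (f i)) /\
  (forall f g, M f -> M g -> forall i, f i = g i -> f = g).
have [|M [[MF Minj] Mmax]] := @Zorn_bigcup _ P.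
  move=> G GP Gtot; split=> [f [M GM Mf]|f g [M GM Mf] [N GN Ng] i].
    exact: (GP M GM).1.
  have [MN|NM] := Gtot _ _ GM GN.
    exact: (GP N GN).2 (MN _ Mf) Ng i.
  exact: (GP M GM).2 Mf (NM _ Ng) i.
have [[i Fi]|noi] :=
    pselect (exists i, forall u, F i u -> exists2 f, M f & f i = u).
  exists i => j; apply: card_le_trans (card_le_of_surj Fi) _.
  apply: (@card_le_of_inj _ _ _ _ (fun f => f j)) => [f Mf|f g Mf Mg].
    exact: MF.
  exact: Minj Mf Mg j.
have {}noi i : exists u, F i u /\ forall f, M f -> f i <> u.
  apply: contrapT => nou; apply: noi; exists i => u Fu.
  apply: contrapT => nof; apply: nou; exists u; split=> // f Mf fu.
  by apply: nof; exists f.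
pose f i := projT1 (cid (noi i)).
have fF i : F i (f i) := (projT2 (cid (noi i))).1.
have fN i g : M g -> g i <> f i := (projT2 (cid (noi i))).2 g.
exfalso; apply: (Mmax (M `|` [set f])).
  split; first by move=> g Mg; left.
  by move=> /(_ f (or_intror erefl)) Mf; exact: (fN i0 f Mf erefl).
split=> [g [Mg|->]//|g g' [Mg|->] [Mg'|->] i //]; first exact: MF.
- exact: Minj.
- by move=> /(fN _ _ Mg).
- by move=> /esym /(fN _ _ Mg').
Qed.

Lemma card_comparable (T U : Type) (A : set T) (B : set U) :
  A #<= B \/ B #<= A.
Proof.
pose V (b : bool) : Type := if b then T else U.
pose F (b : bool) : set (V b) := if b return set (V b) then A else B.
by have [[] /= FV] := @least_cardinality bool true V F; [left|right];
  [exact: (FV false)|exact: (FV true)].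
Qed.

Lemma card_ltP (T U : Type) (A : set T) (B : set U) :
  card_lt A B <-> ~ (B #<= A).
Proof.
split=> [[AB nAB] BA|nBA].
  by apply: nAB; rewrite card_eq_le AB BA.
have [AB|//] := card_comparable A B; split=> // eAB; apply: nBA.
by rewrite -(card_le_eql eAB) card_lexx.
Qed.

Lemma card_le_lt_trans (T U V : Type) (A : set T) (B : set U) (C : set V) :
  A #<= B -> card_lt B C -> card_lt A C.
Proof.
move=> AB /card_ltP nCB; apply/card_ltP => CA; apply: nCB.
exact: card_le_trans AB.
Qed.

Lemma card_lt_le_trans (T U V : Type) (A : set T) (B : set U) (C : set V) :
  card_lt A B -> B #<= C -> card_lt A C.
Proof.
move=> /card_ltP nBA BC; apply/card_ltP => CA; apply: nBA.
exact: card_le_trans CA.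
Qed.

Lemma greater_than_aleph2_uncountable (T : Type) :
  greater_than_aleph 2 T -> card_lt [set: nat] [set: T].
Proof.
move=> [A2 [/= [A1 [_ [A0 [_ A0nat A01 _]] A12 _]] A2T]].
have le01 : [set: nat] #<= A0 by rewrite -(card_le_eql A0nat) card_lexx.
apply: card_le_lt_trans (card_le_trans le01 A01.1) _.
exact: card_le_lt_trans A12.1 A2T.
Qed.

End Cardinals.

(** * Least elements and suprema in a well-order *)

Section WellOrder.
Context {d : Order.disp_t} {T : orderType d}.
Hypothesis wo : well_order (fun x y : T => (x <= y)%O).
Implicit Types (A B C S : set T) (a b x y z : T).

Lemma ex_least A : A !=set0 ->
  exists2 x, A x & forall y, A y -> (x <= y)%O.
Proof.
move=> [a Aa].
have [|x [[xA xmin] _]] := wo (A := fun x => `[< A x >]).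
  by exists a; apply/asboolP.
exists x; first by move/asboolP: xA.
by move=> y Ay; apply: xmin; apply/asboolP.
Qed.

Lemma lt_wf (P : T -> Prop) :
  (forall a, (forall b, (b < a)%O -> P b) -> P a) -> forall a, P a.
Proof.
move=> IH a; apply: contrapT => nPa.
have [|x nPx xmin] := @ex_least [set x | ~ P x]; first by exists a.
apply: nPx; apply: IH => b bx; apply: contrapT => /xmin.
by rewrite leNgt bx.
Qed.

(** [x0] is the value at the empty set. *)
Definition least x0 A := xget x0 [set x | A x /\ forall y, A y -> (x <= y)%O].

Lemma leastP x0 A : A !=set0 ->
  A (least x0 A) /\ forall y, A y -> (least x0 A <= y)%O.
Proof.
move=> /ex_least[x Ax xmin].
by apply: (@xgetPex _ x0 [set x | A x /\ forall y, A y -> (x <= y)%O]); exists x.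
Qed.

Definition lub x0 A := least x0 [set b | forall x, A x -> (x <= b)%O].

Lemma le_lub x0 A b : (forall x, A x -> (x <= b)%O) ->
  forall x, A x -> (x <= lub x0 A)%O.
Proof.
move=> Ab; have [|+ _] := @leastP x0 [set c | forall x, A x -> (x <= c)%O].
  by exists b.
exact.
Qed.

Lemma lub_le x0 A b : (forall x, A x -> (x <= b)%O) -> (lub x0 A <= b)%O.
Proof.
move=> Ab; have [|_] := @leastP x0 [set c | forall x, A x -> (x <= c)%O].
  by exists b.
exact.
Qed.

Lemma lt_lub x0 A b : (exists c, forall x, A x -> (x <= c)%O) ->
  (b < lub x0 A)%O -> exists2 x, A x & (b < x)%O.
Proof.
move=> [c Ac] blub; apply: contrapT => nx.
move: blub; apply/negP; rewrite -leNgt; apply: lub_le => x Ax.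
by rewrite leNgt; apply/negP => bx; apply: nx; exists x.
Qed.

End WellOrder.

(** * Small subsets of a regular cardinal *)

Section Regular.
Context {d : Order.disp_t} {T : orderType d}.
Hypothesis regT : regular_cardinal T.
Implicit Types (A B C : set T) (a b x y z : T).

Lemma regular_inhabited : inhabited T.
Proof.
have [_ /infinite_setN0 [x _] _ _] := regT; exact: (inhabits x).
Qed.

Lemma below_small a : card_lt (below a) [set: T].
Proof. by have [_ _] := regT. Qed.

Lemma small_bounded A : card_lt A [set: T] ->
  exists b, forall x, A x -> (x < b)%O.
Proof.
move=> /card_ltP nTA; have [_ _ _ [_ Tmin]] := regT.
apply: contrapT => nob; apply: nTA; apply: Tmin; split=> // x _.
apply: contrapT => nx; apply: nob; exists x => y Ay; rewrite ltNge.
by apply/negP => xy; apply: nx; exists y.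
Qed.

Lemma finite_small (U : Type) (A : set U) :
  finite_set A -> card_lt A [set: T].
Proof.
move=> finA; apply/card_ltP => TA; have [_ Tinf _ _] := regT; apply: Tinf.
exact: card_le_finite TA finA.
Qed.

Lemma ex_gt a : exists b, (a < b)%O.
Proof.
have [b ab] := small_bounded (finite_small (finite_set1 a)).
by exists b; exact: ab.
Qed.

(** An injection of T into the union would split T into few pieces, each of them
bounded as it is small; the bounds would themselves be few, hence bounded. *)
Lemma bigcup_small (I U : Type) (J : set I) (F : I -> set U) :
    card_lt J [set: T] -> (forall i, J i -> card_lt (F i) [set: T]) ->
  card_lt (\bigcup_(i in J) F i) [set: T].
Proof.
move=> smallJ smallF; apply/card_ltP => TF.
have [t0] := regular_inhabited.
have [u0 _] : (\bigcup_(i in J) F i) !=set0.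
  apply: contrapT => /nonemptyPn F0; move: TF; rewrite F0 card_le0 => /eqP T0.
  by have : [set: T] t0 by []; rewrite T0.
have [f [fF finj]] := card_le_exinj u0 TF.
have /choice[b bP] i : exists b, J i -> forall x, F i (f x) -> (x < b)%O.
  have [Ji|nJi] := pselect (J i); last by exists t0.
  have [|b fb] := @small_bounded [set x | F i (f x)]; last by exists b.
  apply: card_le_lt_trans (smallF i Ji).
  by apply: (@card_le_of_inj _ _ _ _ f) => // x y _ _; apply: finj.
have [c cP] : exists c, forall x, (b @` J) x -> (x < c)%O.
  by apply: small_bounded; apply: card_le_lt_trans smallJ; exact: card_image_le.
have [i Ji Fi] := fF c Logic.I.
have := lt_trans (bP i Ji c Fi) (cP (b i) (ex_intro2 _ _ i Ji erefl)).
by rewrite ltxx.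
Qed.

Lemma setU_small (U : Type) (A B : set U) :
  card_lt A [set: T] -> card_lt B [set: T] -> card_lt (A `|` B) [set: T].
Proof.
move=> smallA smallB.
have -> : A `|` B = \bigcup_(i in [set: bool]) (if i then A else B).
  apply/seteqP; split=> [x [Ax|Bx]|x [[] _]].
  - by exists true.
  - by exists false.
  - by left.
  - by right.
apply: bigcup_small => [|[] _ //]; exact/finite_small/finite_finset.
Qed.

Definition seqs_in (U : eqType) (D : set U) : set (seq U) :=
  [set s | forall u : U, u \in s -> D u].

Lemma seqs_small (U : eqType) (D : set U) : card_lt [set: nat] [set: T] ->
  card_lt D [set: T] -> card_lt (seqs_in D) [set: T].
Proof.
move=> unc smallD.
pose W n := [set s | seqs_in D s /\ size s = n].
have -> : seqs_in D = \bigcup_(n in [set: nat]) W n.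
  by apply/seteqP; split=> [s Ds|s [n _ []]//]; exists (size s).
apply: bigcup_small => // n _; elim: n => [|n IH].
  apply: card_le_lt_trans (finite_small (finite_set1 ([::] : seq U))).
  by apply: subset_card_le => -[|? ?] [_ //].
apply: (@card_le_lt_trans _ _ _ _ (\bigcup_(x in D) (cons x @` W n))).
  apply: subset_card_le => -[|x s] [] // Dxs [sn].
  exists x; first by apply: Dxs; rewrite mem_head.
  by exists s => //; split=> // y ys; apply: Dxs; rewrite in_cons ys orbT.
apply: bigcup_small => // x _; apply: card_le_lt_trans IH.
exact: card_image_le.
Qed.

(** * Stationary sets and Solovay splitting *)

Hypothesis unc : card_lt [set: nat] [set: T].

(** The points closed under [h] form a club: an omega-iteration of a bound for
[h] on initial segments reaches such a point.  Functions of finite sequences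
also cover diagonal intersections of clubs, so this is the only club
constructed. *)
Lemma stationary_closed (S : set T) (h : seq T -> T) :
    (forall a, S a -> limit_ordinal a) -> ~ nonstationary_in [set: T] S ->
  exists2 a, S a & forall s, seqs_in (below a) s -> (h s < a)%O.
Proof.
move=> Slim Sstat; apply: contrapT => noa; apply: Sstat.
exists [set a | forall s, seqs_in (below a) s -> (h s < a)%O]; split; last first.
  by apply/seteqP; split=> // a [Sa ha]; apply: noa; exists a.
have [wo _ _ _] := regT.
split; first split=> // x _.
  have /choice[G GP] a : exists b, (a < b)%O /\
      forall s, seqs_in (below a) s -> (h s < b)%O.
    have [|b hb] := @small_bounded (a |` (h @` seqs_in (below a))).
      apply: setU_small; first exact/finite_small/finite_set1.
      apply: card_le_lt_trans (card_image_le _ _) _.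
      by apply: seqs_small => //; apply: below_small.
    exists b; split=> [|s Ds]; first by apply: hb; left.
    by apply: hb; right; exists s.
  pose g n := iter n G x.
  have gmono m n : (m <= n)%N -> (g m <= g n)%O.
    move=> /subnK <-; elim: (n - m)%N => // k IH.
    by rewrite addSn; apply: le_trans IH _; apply: ltW; exact: (GP _).1.
  have [|b bP] := @small_bounded (range g).
    by apply: card_le_lt_trans unc; exact: card_image_le.
  have [|a ga amin] := ex_least wo (A := [set a | forall n, (g n < a)%O]).
    by exists b => n; apply: bP; exists n.
  exists a; last exact: ltW (ga 0).
  (* a is the supremum of the increasing sequence g *)
  have below_g y : (y < a)%O -> exists n, (y < g n)%O.
    move=> ya; apply: contrapT => ny; have := ya; rewrite ltNge amin // => n.
    rewrite (lt_le_trans ((GP (g n)).1 : (g n < g n.+1)%O)) // leNgt.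
    by apply/negP => yg; apply: ny; exists n.+1.
  move=> s sa; suff [n sn] : exists n, seqs_in (below (g n)) s.
    exact: lt_trans ((GP (g n)).2 s sn) (ga n.+1).
  elim: s sa => [|y s IH] sa; first by exists 0.
  have [|n sn] := IH; first by move=> z zs; apply: sa; rewrite in_cons zs orbT.
  have [|m ym] := below_g y; first by apply: sa; rewrite mem_head.
  exists (maxn m n) => z; rewrite in_cons => /orP[/eqP->|zs].
    exact: lt_le_trans ym (gmono _ _ (leq_maxl _ _)).
  exact: lt_le_trans (sn z zs) (gmono _ _ (leq_maxr _ _)).
move=> a _ [[a0 a0a] alim] [_ Ccof] s sa.
suff [b ba sb] : exists2 b, (b < a)%O & seqs_in (below b) s.
  have [c [hc ca] bc] := Ccof b ba.
  by apply: lt_trans ca; apply: hc => x /sb /lt_le_trans; apply.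
elim: s sa => [|y s IH] sa; first by exists a0.
have [|b ba sb] := IH; first by move=> z zs; apply: sa; rewrite in_cons zs orbT.
have [c yc ca] : exists2 c, (y < c)%O & (c < a)%O.
  by apply: alim; apply: sa; rewrite mem_head.
exists (Order.max b c); first by rewrite gt_max ba.
move=> z; rewrite in_cons /below /= lt_max => /orP[/eqP->|/sb ->//].
by rewrite yc orbT.
Qed.

(** The C-sequence: [C b] is a club of [b] missing [S], for every [b] in [E]. *)
Section Ladders.
Variables (E S : set T) (C : T -> set T).
Hypothesis E_limit : forall b, E b -> limit_ordinal b.
Hypothesis SE : S `<=` E.
Hypothesis C_club : forall b, E b -> club_in (below b) (C b).
Hypothesis C_avoids : forall b, E b -> S `&` C b = set0.

Definition ladder_next (x0 b a : T) := least x0 (C b `&` [set c | (a <= c)%O]).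

Lemma ladder_nextP x0 b a : E b -> (a < b)%O ->
  [/\ C b (ladder_next x0 b a), (a <= ladder_next x0 b a)%O
    & (ladder_next x0 b a < b)%O].
Proof.
have [wo _ _ _] := regT.
move=> Eb ab; have [[Cb /(_ a ab)[c Cc ac]] _] := C_club Eb.
have [|[Cn an] _] := leastP wo x0 (A := C b `&` [set c | (a <= c)%O]).
  by exists c.
by split=> //; exact: Cb.
Qed.

Lemma ladder_next_le x0 b a c :
  C b c -> (a <= c)%O -> (ladder_next x0 b a <= c)%O.
Proof.
have [wo _ _ _] := regT.
move=> Cc ac; have [|_] := leastP wo x0 (A := C b `&` [set c | (a <= c)%O]).
  by exists c.
exact.
Qed.

(** Solovay splitting.  For some [e] the function a |-> min (C_a \ e) takes
unboundedly many values g on stationary subsets [P e g] of S; merging fibres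
then leaves lambda many of them.  Otherwise, for each e all values from [B e]
on have a nonstationary fibre, avoided by a club [D].  Let a < b in S be closed
under B and lie in the diagonal intersection of these clubs.  For e < a the
value min (C_b \ e) cannot be [B e] or more, hence lies below a.  So C_b is
cofinal in a, and a is in C_b, although C_b avoids S. *)
Lemma split_stationary : ~ nonstationary_in [set: T] S ->
  exists col : T -> T, forall i,
    ~ nonstationary_in [set: T] (S `&` [set a | col a = i]).
Proof.
move=> Sstat; have [x0] := regular_inhabited.
pose P e g := S `&` [set a | (e < a)%O /\ ladder_next x0 a e = g].
have Slim a (Sa : S a) : limit_ordinal a := E_limit (SE Sa).
have [e eP] : exists e, cofinal_in [set: T]
    [set g | ~ nonstationary_in [set: T] (P e g)].
  apply: contrapT => noe.
  have /choice[B BP] e : exists b, forall g, (b <= g)%O ->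
      nonstationary_in [set: T] (P e g).
    apply: contrapT => nob; apply: noe; exists e; split=> // b _.
    apply: contrapT => ng; apply: nob; exists b => g bg.
    by apply: contrapT => nPg; apply: ng; exists g.
  have /choice[D DP] (p : T * T) : exists D, (B p.1 <= p.2)%O ->
      club_in [set: T] D /\ P p.1 p.2 `&` D = set0.
    have [/BP[D DP]|] := boolP (B p.1 <= p.2)%O; first by exists D.
    by exists set0.
  have /choice[N NP] (q : T * T * T) : exists y, (B q.1.1 <= q.1.2)%O ->
      D q.1 y /\ (q.2 <= y)%O.
    have [/DP[[[_ Dcof] _] _]|] := boolP (B q.1.1 <= q.1.2)%O; last by exists x0.
    by have [y Dy qy] := Dcof q.2 Logic.I; exists y.
  (* closure under h means closure under B, and being a limit of each club
     D (e, g) with e and g below *)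
  pose h s := match s with
    | [:: e] => B e | [:: e; g; x] => N (e, g, x) | _ => x0 end.
  have [a Sa ha] := stationary_closed h Slim Sstat.
  have [b Sb hb] := stationary_closed (fun s => Order.max a (h s)) Slim Sstat.
  have ab : (a < b)%O.
    by have := hb [::]; rewrite gt_max => /(_ _)/andP[] // ?; rewrite in_nil.
  have {}hb s : seqs_in (below b) s -> (h s < b)%O.
    by move=> /hb; rewrite gt_max => /andP[].
  have Ca : C b a.
    apply: (C_club (SE Sb)).2 => //; first exact: Slim.
    split=> [c []//|e ea]; have eb := lt_trans ea ab.
    have [Cm em mb] := ladder_nextP x0 (SE Sb) eb.
    exists (ladder_next x0 b e) => //; split=> //.
    have Bea : (B e < a)%O.
      by apply: (ha [:: e]) => y; rewrite inE => /eqP->.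
    apply: lt_trans Bea; rewrite ltNge; apply/negP => Bm.
    have [Dclub DP0] := DP (e, ladder_next x0 b e) Bm.
    suff Db : D (e, ladder_next x0 b e) b.
      by have : set0 b by rewrite -DP0.
    apply: Dclub.2 => //; first exact: Slim.
    split=> [c []//|x xb]; have [Dy xy] := NP (e, ladder_next x0 b e, x) Bm.
    exists (N (e, ladder_next x0 b e, x)) => //; split=> //.
    apply: (hb [:: e; _; x]) => y.
    by rewrite !inE => /or3P[] /eqP->.
  by have : set0 a by rewrite -(C_avoids (SE Sb)).
have leG : [set: T] #<= [set g | ~ nonstationary_in [set: T] (P e g)].
  by have [_ _ _ [_]] := regT; apply.
(* f enumerates lambda many stationary values, and f' is a left inverse of f *)
have [f [fG finj]] := card_le_exinj x0 leG.
have /choice[f' f'P] g : exists i, forall j, f j = g -> j = i.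
  have [[i <-]|ni] := pselect (exists i, f i = g).
    by exists i => j; exact: finj.
  by exists x0 => j fj; exfalso; apply: ni; exists j.
exists (fun a => f' (ladder_next x0 a e)) => i [D [Dclub D0]].
apply: (fG i Logic.I); exists D; split=> //.
apply/seteqP; split=> // a [[Sa [_ nfi]] Da].
rewrite -D0; split=> //; split=> //=.
by apply/esym/f'P.
Qed.

End Ladders.

End Regular.

(** * Walks *)

Lemma E_lt_of_cofinal (K : Type) (d : Order.disp_t) (L : orderType d) (a : L)
    (A : set L) : limit_ordinal a -> cofinal_in (below a) A ->
  card_lt A [set: K] -> E_lt K L a.
Proof.
move=> alim Acof smallA; split=> //.
have [[C Ccof] /= Cmin] := @least_cardinality {D | cofinal_in (below a) D}
  (exist _ A Acof) (fun=> L) (fun D => sval D).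
exists C; split; first split=> // D Dcof; first exact: (Cmin (exist _ D Dcof)).
exact: card_le_lt_trans (Cmin (exist _ A Acof)) smallA.
Qed.

Section Walks.
Context {d : Order.disp_t} {L : orderType d}.
Hypothesis regL : regular_cardinal L.
Variables (E S : set L) (C : L -> set L) (x0 : L).
Hypothesis E_limit : forall b, E b -> limit_ordinal b.
Hypothesis SE : S `<=` E.
Hypothesis C_club : forall b, E b -> club_in (below b) (C b).
Hypothesis C_avoids : forall b, E b -> S `&` C b = set0.
Implicit Types (a b r : L) (x : set L).

(** The next node of the walk from [b] towards [a].  The set [x] is the largest
member of the coloured chain; outside [E] its trace below [b] replaces the
missing club. *)
Definition walk_step x b a : L :=
  if `[< E b >] then ladder_next C x0 b a else lub x0 (x `&` below b).

(** [split_node x a a' b r]: the walks from [b] towards [a] and [a'] agree down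
to [r] and part there. *)
Inductive split_node x a a' : L -> L -> Prop :=
| split_here b : walk_step x b a <> walk_step x b a' -> split_node x a a' b b
| split_later b r : walk_step x b a = walk_step x b a' ->
    split_node x a a' (walk_step x b a) r -> split_node x a a' b r.

Lemma split_node_unique x a a' b r r' :
  split_node x a a' b r -> split_node x a a' b r' -> r = r'.
Proof.
move=> sr; elim: sr r' => {b r} [b neq|b r eq _ IH] r' sr'.
  by case: sr' neq => [//|{}b r eq _ neq]; case: neq.
by case: sr' eq IH => [{}b neq eq|{}b {}r' _ + _ IH]; [case: neq|exact: IH].
Qed.

(** Walks towards ordinals close to [t] part at [t].  The quantifiers say how
[a] and [a'] have to be chosen: [a] close to [t] in terms of [b], then [a']
close to [t] in terms of [a].  The proof is by induction on [b], as one step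
leads from [b] > [t] to a smaller node that is still at least [t]. *)
Lemma walk_splits x t b :
    (forall c, ~ E c -> limit_ordinal c ->
       ~ cofinal_in (below c) (x `&` below c)) ->
    S t -> x t -> (t <= b)%O ->
  exists2 z, (z < t)%O & forall a, (z < a)%O -> (a < t)%O ->
    exists2 y, (y < t)%O & forall a', (y < a')%O -> (a' < t)%O ->
      split_node x a a' b t.
Proof.
have [wo _ _ _] := regL.
move=> xsmall St xt; have Et := SE St; have [[t0 t0t] tlim] := E_limit Et.
elim/(lt_wf wo): b => b IH; rewrite le_eqVlt => /orP[/eqP<-|tb].
  (* at t itself: the node towards a lies below a' *)
  exists t0 => // a _ at_.
  have [_ _ nt] := ladder_nextP regL C_club x0 Et at_.
  exists (ladder_next C x0 t a) => // a' na' a't; apply: split_here.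
  have [_ an _] := ladder_nextP regL C_club x0 Et a't.
  rewrite /walk_step asboolT // => eqn; move: na'.
  by rewrite eqn ltNge an.
have [Eb|nEb] := pselect (E b).
  (* C b misses t, so it is bounded below t by z1 *)
  have nCt : ~ C b t.
    by move=> Ct; have : set0 t by rewrite -(C_avoids Eb).
  have [z1 z1t Cz1] : exists2 z, (z < t)%O &
      forall c, C b c -> (z <= c)%O -> (t < c)%O.
    apply: contrapT => noz; apply: (nCt); apply: (C_club Eb).2 => //.
      exact: E_limit.
    split=> [c []//|z zt]; apply: contrapT => noc; apply: noz; exists z => //.
    move=> c Cc zc; rewrite lt_neqAle leNgt; apply/andP; split.
      by apply/eqP => tc; apply: nCt; rewrite tc.
    by apply/negP => ct; apply: noc; exists c.
  pose c := ladder_next C x0 b t.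
  have [Cc tc cb] := ladder_nextP regL C_club x0 Eb tb.
  have step_eq a : (z1 < a)%O -> (a < t)%O -> walk_step x b a = c.
    move=> z1a at_; rewrite /walk_step asboolT //.
    have [Cn an _] := ladder_nextP regL C_club x0 Eb (lt_trans at_ tb).
    apply/le_anti/andP; split.
      by apply: (ladder_next_le regL) => //; exact: le_trans (ltW at_) tc.
    apply: (ladder_next_le regL) => //; apply/ltW/Cz1 => //.
    exact: le_trans (ltW z1a) an.
  have [z zt zP] := IH c cb tc.
  exists (Order.max z1 z); first by rewrite gt_max z1t.
  move=> a; rewrite gt_max => /andP[z1a za] at_.
  have [y yt yP] := zP a za at_.
  exists (Order.max z1 y); first by rewrite gt_max z1t.
  move=> a'; rewrite gt_max => /andP[z1a' ya'] a't.
  apply: split_later; first by rewrite !step_eq.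
  by rewrite step_eq //; exact: yP.
(* outside E the step does not depend on a *)
pose c := lub x0 (x `&` below b).
have step_eq a : walk_step x b a = c by rewrite /walk_step asboolF.
have xb_ub e : (x `&` below b) e -> (e <= b)%O by case=> _; exact: ltW.
have tc : (t <= c)%O by apply: (le_lub wo x0 xb_ub).
have cb : (c < b)%O.
  rewrite lt_neqAle (lub_le wo x0 xb_ub) andbT; apply/eqP => cb.
  have gtx e : (e < b)%O -> exists2 u, (x `&` below b) u & (e < u)%O.
    by move=> eb; apply: (lt_lub wo (x0 := x0)); [exists b|rewrite -/c cb].
  apply: (xsmall b nEb).
    split; first by exists t.
    by move=> e /gtx[u [_ ub] eu]; exists u.
  split=> [e []//|e /gtx[u xu eu]]; exists u => //; exact: ltW.
have [z zt zP] := IH c cb tc.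
exists z => // a za at_; have [y yt yP] := zP a za at_.
exists y => // a' ya' a't; apply: split_later; first by rewrite !step_eq.
by rewrite step_eq; exact: yP.
Qed.

End Walks.

(** * Chains of three sets *)

(** Recovering a chain of length three from the set of its members. *)
Section Chains.
Context {L : Type}.
Implicit Types (A : set (set L)) (x y z : set L).

Definition top_set A := \bigcup_(x in A) x.
Definition bottom_set A := \bigcap_(x in A) x.
Definition middle_set A := top_set (A `\ top_set A).

Lemma chain3_sets x y z : x `<` y -> y `<` z ->
  [/\ bottom_set [set x; y; z] = x, middle_set [set x; y; z] = y
    & top_set [set x; y; z] = z].
Proof.
move=> [xy nyx] [yz nzy].
have topz : top_set [set x; y; z] = z.
  apply/seteqP; split=> [u [_ [[->|->]|->]] //|u zu].
  - by move=> xu; exact/yz/xy.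
  - exact: yz.
  - by exists z => //; right.
split=> //.
  apply/seteqP; split=> [u|u xu _ [[->|->]|->] //].
  - by apply; left; left.
  - exact: xy.
  - exact/yz/xy.
rewrite /middle_set topz; apply/seteqP; split=> [u [_ [[[->|->]|->] nz]]|u yu] //.
- exact: xy.
- by case: nz.
- exists y => //; split; first by left; right.
  by move=> yz_eq; apply: nzy; rewrite -yz_eq.
Qed.

Lemma nchains3 (X : set (set L)) x y z : X x -> X y -> X z ->
  x `<` y -> y `<` z -> nchains 3 X [set x; y; z].
Proof.
move=> Xx Xy Xz xy yz; exists (fun i => nth x [:: x; y; z] (val i)); split.
- by case=> -[|[|[|]]].
- have xz : x `<` z.
    split; first by move=> u /xy.1 /yz.1.
    by move=> zx; apply: yz.2 => u /zx /xy.1.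
  by case=> -[|[|[|?]]] ? [[|[|[|?]]] ?].
- apply/seteqP; split=> [u [[->|->]|->]|_ [[[|[|[|?]]] ?] _ <-] //=].
  + by exists (@Ordinal 3 0 isT).
  + by exists (@Ordinal 3 1 isT).
  + by exists (@Ordinal 3 2 isT).
  + by left; left.
  + by left; right.
  + by right.
Qed.

Lemma card_chain3 x y z : x `<` y -> y `<` z -> [set x; y; z] #= `I_3.
Proof.
move=> xy yz.
have nxy : x <> y by move=> e; apply: xy.2; rewrite e; exact: subset_refl.
have nyz : y <> z by move=> e; apply: yz.2; rewrite e; exact: subset_refl.
have xz : x <> z by move=> e; apply: yz.2; rewrite -e; exact: xy.1.
have -> : [set x; y; z] = (fun i => nth x [:: x; y; z] i) @` `I_3.
  apply/seteqP; split=> [u [[->|->]|->]|_ [[|[|[|?]]] //= _ <-]].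
  + by exists 0.
  + by exists 1.
  + by exists 2.
  + by left; left.
  + by left; right.
  + by right.
apply: inj_card_eq => -[|[|[|m]]] [|[|[|n]]] /set_mem //= ? /set_mem //= ? //.
all: by move/esym.
Qed.

End Chains.

(** * The negative partition relation *)

Theorem theorem1p5 (dK dL : Order.disp_t) (K : orderType dK) (L : orderType dL)
  (regK : regular_cardinal K) (regL : regular_cardinal L)
  (gtK : greater_than_aleph 2 K) (gtL : greater_than_aleph 2 L)
  (leKL : [set: K] #<= [set: L])
  (S : set L) (S_E : S `<=` E_lt K L) (S_stat : stationary_in [set: L] S)
  (S_nonrefl : forall a : L, E_lt K L a ->
     nonstationary_in (below a) (S `&` below a)) :
  not_square_arrow 3 K L.
Proof.
have uncK := greater_than_aleph2_uncountable gtK.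
have uncL := greater_than_aleph2_uncountable gtL.
have [wo _ _ _] := regL; have [x0] := regular_inhabited regL.
pose E : set L := E_lt K L.
have E_limit b : E b -> limit_ordinal b by case.
have /choice[C CP] b : exists C, E b -> club_in (below b) C /\ S `&` C = set0.
  have [Eb|nEb] := pselect (E b); last by exists set0.
  have [C [Cclub C0]] := S_nonrefl b Eb; exists C => _; split=> //.
  by rewrite -C0 -setIA (setIidr (Cclub.1.1)).
have C_club b (Eb : E b) : club_in (below b) (C b) := (CP b Eb).1.
have C_avoids b (Eb : E b) : S `&` C b = set0 := (CP b Eb).2.
have [col colP] :=
  split_stationary regL uncL E_limit S_E C_club C_avoids S_stat.2.
pose sup := lub x0.
pose color A := col (xget x0 [set r | split_node E C x0 (top_set A)
  (sup (bottom_set A)) (sup (middle_set A)) (sup (top_set A)) r]).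
exists (fun A => color (set_val A)) => X [XP Xunb].
apply/seteqP; split=> // i _.
have boundedP x : P_kl K L x -> exists b, forall u, x u -> (u < b)%O.
  by move=> xP; apply: (small_bounded regL); exact: card_lt_le_trans leKL.
have le_sup x u : P_kl K L x -> x u -> (u <= sup x)%O.
  move=> /boundedP[b bP]; apply: (@le_lub _ _ wo x0 x b) => v /bP; exact: ltW.
(* G (y, e) extends y inside X beyond e *)
have /choice[G GP] (p : set L * L) : exists z, P_kl K L p.1 ->
    [/\ X z, p.1 `<` z & (p.2 < sup z)%O].
  case: p => y e /=; have [yP|nyP] := pselect (P_kl K L y); last by exists set0.
  have [b bP] := boundedP y yP; have [u bu] := ex_gt regL (Order.max e b).
  have [|z Xz yz] := Xunb (y `|` [set u]).
    by apply: setU_small => //; exact/finite_small/finite_set1.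
  exists z => _; split=> //.
    split=> [v yv|/(_ u (yz u (or_intror erefl)))/bP]; first by apply: yz; left.
    by rewrite ltNge ltW // (le_lt_trans _ bu) // le_max lexx orbT.
  apply: lt_le_trans (le_sup z u (XP _ Xz) (yz u (or_intror erefl))).
  by apply: le_lt_trans bu; rewrite le_max lexx.
have [g0 Xg0 _] : exists2 y, X y & set0 `<=` y.
  apply: Xunb; exact: (finite_small regK (finite_set0 _)).
pose g := fix g s := if s is e :: s' then G (g s', e) else g0.
have Xg s : X (g s) by elim: s => //= e s Xs; have [] := GP (g s, e) (XP _ Xs).
have g_proper e s : g s `<` g (e :: s) by have [] := GP (g s, e) (XP _ (Xg s)).
have g_sup e s : (e < sup (g (e :: s)))%O.
  by have [] := GP (g s, e) (XP _ (Xg s)).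
(* t is the node at which the walks are going to part *)
have [|t [St colt] gt] :=
    stationary_closed regL uncL (fun s => sup (g s)) _ (colP i).
  by move=> a [/S_E []].
have [[_ tlim] [D [[Dcof _] Dsmall]]] := S_E t St.
(* z covers all the candidates g s with s in D, and contains t *)
have [|z Xz gz] := Xunb ((\bigcup_(s in seqs_in D) g s) `|` [set t]).
  apply: setU_small => //; last exact/finite_small/finite_set1.
  apply: bigcup_small => // [|s _]; last exact: XP.
  exact: seqs_small.
have zt : z t by apply: gz; right.
have zsmall c : ~ E c -> limit_ordinal c ->
    ~ cofinal_in (below c) (z `&` below c).
  move=> nEc clim /(E_lt_of_cofinal clim)Ec; apply/nEc/Ec.
  apply: card_le_lt_trans (XP _ Xz); exact: subset_card_le.
have tz : (t <= sup z)%O by apply: le_sup => //; exact: XP.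
have [r rt rP] :=
  walk_splits regL x0 E_limit S_E C_club C_avoids zsmall St zt tz.
have [e De re] := Dcof.2 r rt.
have D1 : seqs_in D [:: e] by move=> u; rewrite inE => /eqP->.
have D_lt s : seqs_in D s -> (sup (g s) < t)%O.
  by move=> Ds; apply: gt => u /Ds /Dcof.1.
have [y yt yP] := rP _ (le_lt_trans re (g_sup e [::])) (D_lt _ D1).
have [f Df yf] := Dcof.2 y yt.
have D2 : seqs_in D [:: f; e] by move=> u; rewrite !inE => /orP[]/eqP->.
have split_t := yP _ (le_lt_trans yf (g_sup f [:: e])) (D_lt _ D2).
have gfz : g [:: f; e] `<` z.
  split=> [u gu|/(_ t zt) gtt]; first by apply: gz; left; exists [:: f; e].
  by have := D_lt _ D2; rewrite ltNge le_sup //; exact: XP.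
pose A := [set g [:: e]; g [:: f; e]; z].
have [Abot Amid Atop] := chain3_sets (g_proper f [:: e]) gfz.
have AX : nchains 3 X A by apply: nchains3.
have AP : nsubsets 3 (P_kl K L) A.
  split; first by move=> _ [[->|->]|->]; exact: XP.
  exact: card_chain3.
exists (SigSub (mem_set AP)); first exact: AX.
rewrite /color /= Abot Amid Atop -[RHS]colt; congr col.
apply/esym/(split_node_unique split_t).
exact: (@xgetPex _ x0 (split_node E C x0 z (sup (g [:: e]))
  (sup (g [:: f; e])) (sup z)) (ex_intro _ t split_t)).
Qed.
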